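(* Let $S$ be a good semigroup of $\mathbb{N}^2$ and let $R$ be an algebroid curve (with two branches) such that $v(R)=S$. Then $\operatorname{edim}(S)\ge\operatorname{edim}(R)$.
   Context: $\mathbb{N}=\{0,1,2,\dots\}$. A submonoid $S$ of $(\mathbb{N}^2,+)$ is a good semigroup if: (G1) $\boldsymbol{\alpha},\boldsymbol{\beta}\in S$ implies $\min(\boldsymbol{\alpha},\boldsymbol{\beta})=(\min\{\alpha_1,\beta_1\},\min\{\alpha_2,\beta_2\})\in S$; (G2) there is $\boldsymbol{\delta}\in\mathbb{N}^2$ with $\boldsymbol{\delta}+\mathbb{N}^2\subseteq S$; (G3) if $\boldsymbol{\alpha},\boldsymbol{\beta}\in S$, $\boldsymbol{\alpha}\ne\boldsymbol{\beta}$ and $\alpha_i=\beta_i$ for some $i$, then there is $\boldsymbol{\epsilon}\in S$ with $\epsilon_i>\alpha_i=\beta_i$ and $\epsilon_j\ge\min\{\alpha_j,\beta_j\}$ for $j\neq i$, with equality if $\alpha_j\ne\beta_j$. Good semigroups are always assumed local: if $\boldsymbol{\alpha}\in S$ has a zero coordinate, then $\boldsymbol{\alpha}=\boldsymbol{0}$. Let $\overline{\mathbb{N}}=\mathbb{N}\cup\{\infty\}$ with $a<\infty$ for $a\in\mathbb{N}$ and $x+\infty=\infty$ for all $x$. Put $S_1^\infty=\{(a,\infty): a\in\mathbb{N},\ \exists\,\tilde y\ \forall y\ge\tilde y,\ (a,y)\in S\}$, $S_2^\infty=\{(\infty,b): b\in\mathbb{N},\ \exists\,\tilde x\ \forall x\ge\tilde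 x,\ (x,b)\in S\}$, $S^\infty=S_1^\infty\cup S_2^\infty\cup\{(\infty,\infty)\}$, $\Gamma_S=S\cup S^\infty$. A good semigroup is identified with $\Gamma_S$, so ''$S$ contains $\eta$'' means $\eta\subseteq\Gamma_S$. $\boldsymbol{\alpha}\in\Gamma_S\setminus\{\boldsymbol{0}\}$ is irreducible if $\boldsymbol{\alpha}=\boldsymbol{\beta}+\boldsymbol{\gamma}$ with $\boldsymbol{\beta},\boldsymbol{\gamma}\in\Gamma_S$ implies $\boldsymbol{\alpha}=\boldsymbol{\beta}$ or $\boldsymbol{\alpha}=\boldsymbol{\gamma}$. $\boldsymbol{\alpha}\in\Gamma_S$ is absolute if $\boldsymbol{\alpha}\in S^\infty$, or $\boldsymbol{\alpha}\in S\cap\mathbb{N}^2$ and no $\boldsymbol{\beta}\in S\cap\mathbb{N}^2$ satisfies ($\beta_1=\alpha_1,\beta_2>\alpha_2$) or ($\beta_2=\alpha_2,\beta_1>\alpha_1$). $I_A(S)$ is the set of irreducible absolute elements of $\Gamma_S$. For $\eta\subseteq\overline{\mathbb{N}}^2$, $S_\eta$ is the family of good semigroups containing $\eta$ that are minimal for inclusion among good semigroups containing $\eta$. The embedding dimension of $S$ is $\operatorname{edim}(S)=\min\{|\eta|: \eta\subseteq I_A(S),\ S\in S_\eta\}$. A two-branches algebroid curve is a one-dimensional ring $R=\mathbb{K}[\![x_1,\dots,x_n]\!]/Q$, $\mathbb{K}$ a field, where $Q=P_1\cap P_2$ with $P_1\neq P_2$ the two minimal primes over $Q$; with $R_i=\mathbb{K}[\![x_1,\dots,x_n]\!]/P_i$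 one has $R\hookrightarrow R_1\times R_2$ and $\overline{R}\cong\overline{R_1}\times\overline{R_2}\cong\mathbb{K}[\![t_1]\!]\times\mathbb{K}[\![t_2]\!]$. For $r=(r_1,r_2)\in R$ put $v(r)=(v_1(r),v_2(r))$, where $v_i(r)$ is the $t_i$-adic order of $r_i$ ($\infty$ if $r_i=0$). The value semigroup is $v(R)=\{v(r): r\in R\text{ not a zerodivisor}\}\subseteq\mathbb{N}^2$. $\operatorname{edim}(R)$ is the usual embedding dimension of the local ring $R$ (minimal number of generators of its maximal ideal). *)

(* Defs.v *)
From HB Require Import structures.
From mathcomp Require Import all_boot all_order all_algebra.
From mathcomp Require Import boolp classical_sets cardinality.
From mathcomp Require Import mpoly.

Set Implicit Arguments.
Unset Strict Implicit.
Unset Printing Implicit Defensive.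

Import GRing.Theory.

Local Open Scope classical_set_scope.

(** * Good semigroups of N^2 *)

(* [None] stands for infinity. *)
Definition enat := option nat.

Definition eadd (x y : enat) : enat :=
  if x is Some a then (if y is Some b then Some (a + b) else None) else None.

Definition eadd2 (x y : enat * enat) : enat * enat :=
  (eadd x.1 y.1, eadd x.2 y.2).

Definition fin2 (a : nat * nat) : enat * enat := (Some a.1, Some a.2).

Definition submonoid2 (S : set (nat * nat)) : Prop :=
  S (0, 0) /\ forall a b, S a -> S b -> S (a.1 + b.1, a.2 + b.2).

(* The last clause is locality, which is a standing assumption. *)
Record good_semigroup (S : set (nat * nat)) : Prop := GoodSemigroup {
  good_submonoid : submonoid2 S;
  good_min : forall a b, S a -> S b -> S (minn a.1 b.1, minn a.2 b.2);
  good_conductor : exists d : nat * nat,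
    forall x : nat * nat, S (d.1 + x.1, d.2 + x.2);
  good_raise1 : forall a b, S a -> S b -> a <> b -> a.1 = b.1 ->
    exists2 e, S e & [/\ a.1 < e.1, minn a.2 b.2 <= e.2
                      & a.2 <> b.2 -> e.2 = minn a.2 b.2];
  good_raise2 : forall a b, S a -> S b -> a <> b -> a.2 = b.2 ->
    exists2 e, S e & [/\ a.2 < e.2, minn a.1 b.1 <= e.1
                      & a.1 <> b.1 -> e.1 = minn a.1 b.1];
  good_local : forall a, S a -> a.1 = 0 \/ a.2 = 0 -> a = (0, 0)
}.

Definition inf1 (S : set (nat * nat)) : set (enat * enat) :=
  [set (Some a, None) | a in
    [set a : nat | exists y0, forall y, y0 <= y -> S (a, y)]].

Definition inf2 (S : set (nat * nat)) : set (enat * enat) :=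
  [set (None, Some b) | b in
    [set b : nat | exists x0, forall x, x0 <= x -> S (x, b)]].

Definition infinite_elements (S : set (nat * nat)) : set (enat * enat) :=
  inf1 S `|` inf2 S `|` [set (None, None)].

Definition Gamma (S : set (nat * nat)) : set (enat * enat) :=
  fin2 @` S `|` infinite_elements S.

Definition irreducible (S : set (nat * nat)) (x : enat * enat) : Prop :=
  [/\ Gamma S x, x <> fin2 (0, 0) &
      forall y z, Gamma S y -> Gamma S z -> x = eadd2 y z -> x = y \/ x = z].

Definition absolute (S : set (nat * nat)) (x : enat * enat) : Prop :=
  infinite_elements S x \/
  exists a : nat * nat, [/\ S a, x = fin2 a &
    ~ exists2 b, S b & (b.1 = a.1 /\ a.2 < b.2) \/ (b.2 = a.2 /\ a.1 < b.1)].

Definition irreducible_absolutes (S : set (nat * nat)) : set (enat * enat) :=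
  [set x | irreducible S x /\ absolute S x].

(* [minimal_good eta S] means that S belongs to the family S_eta. *)
Definition minimal_good (eta : set (enat * enat)) (S : set (nat * nat)) :
    Prop :=
  [/\ good_semigroup S, eta `<=` Gamma S &
      forall T, good_semigroup T -> eta `<=` Gamma T -> T `<=` S -> T = S].

Definition is_min (P : nat -> Prop) (n : nat) : Prop :=
  P n /\ forall m, P m -> n <= m.

Definition semigroup_edim (S : set (nat * nat)) (e : nat) : Prop :=
  is_min (fun k => exists eta : set (enat * enat),
    [/\ (eta #= `I_k)%card, eta `<=` irreducible_absolutes S
      & minimal_good eta S]) e.

(** * Formal power series in n variables *)

Record mseries (n : nat) (R : Type) := MSeries { mscoef :> 'X_{1..n} -> R }.

Section MSeries.
Local Open Scope ring_scope.
Context {n : nat} {R : comNzRingType}.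
Local Notation T := (mseries n R).
Implicit Types (f g h : T) (m : 'X_{1..n}).

Lemma mseriesP f g : (forall m, f m = g m) -> f = g.
Proof. by case: f g => [f] [g] /= /funext ->. Qed.

HB.instance Definition _ := gen_eqMixin T.
HB.instance Definition _ := gen_choiceMixin T.

Definition ms_zero : T := MSeries (fun=> 0).
Definition ms_opp f : T := MSeries (fun m => - f m).
Definition ms_add f g : T := MSeries (fun m => f m + g m).
Definition ms_one : T := MSeries (fun m => (m == 0%MM)%:R).
Definition ms_scale (c : R) f : T := MSeries (fun m => c * f m).

(* The bound on the degrees only serves to make the index type finite. *)
Definition ms_mul f g : T := MSeries (fun m =>
  \sum_(k : 'X_{1..n < (mdeg m).+1, (mdeg m).+1} | m == (k.1 + k.2)%MM)
    f k.1 * g k.2).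

Fact ms_addA : associative ms_add.
Proof. by move=> f g h; apply: mseriesP => m /=; rewrite addrA. Qed.
Fact ms_addC : commutative ms_add.
Proof. by move=> f g; apply: mseriesP => m /=; rewrite addrC. Qed.
Fact ms_add0 : left_id ms_zero ms_add.
Proof. by move=> f; apply: mseriesP => m /=; rewrite add0r. Qed.
Fact ms_addN : left_inverse ms_zero ms_opp ms_add.
Proof. by move=> f; apply: mseriesP => m /=; rewrite addNr. Qed.

HB.instance Definition _ :=
  GRing.isZmodule.Build T ms_addA ms_addC ms_add0 ms_addN.

Definition ms_trunc d f : {mpoly R[n]} :=
  \sum_(m : 'X_{1..n < d}) f m *: 'X_[m].

Lemma ms_truncE d f m : (mdeg m < d)%N -> (ms_trunc d f)@_m = f m.
Proof. exact: mcoeff_mpoly. Qed.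

Lemma ms_mul_coef d1 d2 f g (p q : {mpoly R[n]}) m :
  (mdeg m < d1)%N -> (mdeg m < d2)%N ->
  (forall k, (mdeg k < d1)%N -> p@_k = f k) ->
  (forall k, (mdeg k < d2)%N -> q@_k = g k) ->
  ms_mul f g m = (p * q)@_m.
Proof.
move=> d1m d2m pf qg; rewrite mcoeffM /=; apply: eq_bigr => k _.
rewrite pf ?qg //.
- exact: leq_trans (bmdeg k.2) d2m.
- exact: leq_trans (bmdeg k.1) d1m.
Qed.

Fact ms_mulA : associative ms_mul.
Proof.
move=> f g h; apply: mseriesP => m; set d := (mdeg m).+1.
have dm : (mdeg m < d)%N by [].
rewrite (ms_mul_coef (d1 := d) (d2 := d) (p := ms_trunc d f)
          (q := ms_trunc d g * ms_trunc d h)) //; last 2 first.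
- by move=> k; apply: ms_truncE.
- move=> k kd; rewrite -(ms_mul_coef (d1 := d) (d2 := d) (f := g) (g := h)) //;
  by move=> l; apply: ms_truncE.
rewrite mulrA.
rewrite (ms_mul_coef (d1 := d) (d2 := d) (p := ms_trunc d f * ms_trunc d g)
          (q := ms_trunc d h)) //.
- move=> k kd; rewrite -(ms_mul_coef (d1 := d) (d2 := d) (f := f) (g := g)) //;
  by move=> l; apply: ms_truncE.
- by move=> k; apply: ms_truncE.
Qed.

Fact ms_mulC : commutative ms_mul.
Proof.
move=> f g; apply: mseriesP => m; set d := (mdeg m).+1.
rewrite (ms_mul_coef (d1 := d) (d2 := d) (p := ms_trunc d f)
          (q := ms_trunc d g)) //; last 2 first.
- by move=> k; apply: ms_truncE.
- by move=> k; apply: ms_truncE.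
rewrite mulrC -(ms_mul_coef (d1 := d) (d2 := d) (f := g) (g := f)) //;
by move=> k; apply: ms_truncE.
Qed.

Fact ms_mul1 : left_id ms_one ms_mul.
Proof.
move=> f; apply: mseriesP => m; set d := (mdeg m).+1.
rewrite (ms_mul_coef (d1 := d) (d2 := d) (p := 1) (q := ms_trunc d f)) //.
- by rewrite mul1r ms_truncE.
- by move=> k _; rewrite mcoeff1.
- by move=> k; apply: ms_truncE.
Qed.

Fact ms_mulDl : left_distributive ms_mul ms_add.
Proof.
move=> f g h; apply: mseriesP => m /=.
by rewrite -big_split; apply: eq_bigr => k _ /=; rewrite mulrDl.
Qed.

Fact ms_one_neq0 : ms_one != 0.
Proof.
by apply/eqP => /(congr1 (fun f => f 0%MM)) /= /eqP; rewrite eqxx oner_eq0.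
Qed.

HB.instance Definition _ := GRing.Zmodule_isComNzRing.Build T
  ms_mulA ms_mulC ms_mul1 ms_mulDl ms_one_neq0.

Fact ms_scaleA (a b : R) f : ms_scale a (ms_scale b f) = ms_scale (a * b) f.
Proof. by apply: mseriesP => m /=; rewrite mulrA. Qed.
Fact ms_scale1 : left_id 1 ms_scale.
Proof. by move=> f; apply: mseriesP => m /=; rewrite mul1r. Qed.
Fact ms_scaleDr : right_distributive ms_scale +%R.
Proof. by move=> a f g; apply: mseriesP => m /=; rewrite mulrDr. Qed.
Fact ms_scaleDl f : {morph ms_scale^~ f : a b / a + b}.
Proof. by move=> a b; apply: mseriesP => m /=; rewrite mulrDl. Qed.

HB.instance Definition _ := GRing.Zmodule_isLmodule.Build R T
  ms_scaleA ms_scale1 ms_scaleDr ms_scaleDl.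

Fact ms_scaleAl (a : R) f g : a *: (f * g) = a *: f * g.
Proof.
apply: mseriesP => m /=; rewrite mulr_sumr.
by apply: eq_bigr => k _; rewrite mulrA.
Qed.

HB.instance Definition _ := GRing.Lmodule_isLalgebra.Build R T ms_scaleAl.
HB.instance Definition _ := GRing.Lalgebra_isComAlgebra.Build R T.

(* The least degree of a monomial occurring in f; for n = 1 this is the
   t-adic order of f in R[[t]]. *)
Definition ms_order f : enat :=
  match pselect (exists k,
      `[< exists m : 'X_{1..n}, mdeg m = k /\ f m <> 0 >]) with
  | left ex_k => Some (ex_minn ex_k)
  | right _ => None
  end.

End MSeries.

(** * Commutative algebra *)

Section CommutativeAlgebra.
Local Open Scope ring_scope.

(* [idealr_closed] requires ideals to be proper. *)
Definition proper_ideal_set (A : comNzRingType) (I : set A) : Prop :=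
  idealr_closed (mem I).

Definition prime_ideal_set (A : comNzRingType) (P : set A) : Prop :=
  proper_ideal_set P /\ prime_idealr_closed (mem P).

Definition maximal_ideal_set (A : comNzRingType) (M : set A) : Prop :=
  proper_ideal_set M /\
  forall I : set A, proper_ideal_set I -> M `<=` I -> I = M.

Definition minimal_prime_over (A : comNzRingType) (Q P : set A) : Prop :=
  [/\ prime_ideal_set P, Q `<=` P &
      forall P', prime_ideal_set P' -> Q `<=` P' -> P' `<=` P -> P' = P].

Definition prime_chain (A : comNzRingType) (d : nat) : Prop :=
  exists p : nat -> set A,
    (forall i, (i <= d)%N -> prime_ideal_set (p i)) /\
    (forall i, (i < d)%N -> p i `<` p i.+1).

Definition krull_dim (A : comNzRingType) (d : nat) : Prop :=
  prime_chain A d /\ ~ prime_chain A d.+1.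

Definition generated_ideal (A : comNzRingType) (k : nat) (g : 'I_k -> A) :
    set A :=
  [set r | exists c : 'I_k -> A, r = \sum_i c i * g i].

Definition local_edim (A : comNzRingType) (d : nat) : Prop :=
  exists2 M : set A,
    forall M', maximal_ideal_set M' <-> M' = M &
    is_min (fun k => exists g : 'I_k -> A, generated_ideal g = M) d.

Definition is_quotient_map (A B : comNzRingType) (f : {rmorphism A -> B})
    (I : set A) : Prop :=
  (forall b, exists a, f a = b) /\ (forall a, f a = 0 <-> I a).

Definition is_fraction_field (A : comNzRingType) (F : fieldType)
    (iota : {rmorphism A -> F}) : Prop :=
  injective iota /\
  forall z, exists a b, iota b != 0 /\ z = iota a / iota b.

(* nu identifies B with the integral closure of the domain A in its field of
   fractions. *)
Definition is_normalization (A B : comNzRingType) (nu : {rmorphism A -> B}) :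
    Prop :=
  exists (F : fieldType) (iota : {rmorphism A -> F}) (j : {rmorphism B -> F}),
    [/\ is_fraction_field iota, injective j, forall a, j (nu a) = iota a &
        forall z, (exists b, j b = z) <-> integralOver iota z].

(* [curve_ring] is K[[x_1, ..., x_n]] / Q with Q = P1 `&` P2, and [branch_i] is
   K[[x_1, ..., x_n]] / P_i; quotients are given, up to isomorphism of
   K-algebras, by their projections.  The map [nu_i] is the composite of the
   inclusion of [branch_i] in its normalization with an isomorphism of
   K-algebras from the latter to K[[t_i]]. *)
Record algebroid_curve2 (K : fieldType) := AlgebroidCurve2 {
  nvars : nat;
  P1 : set (mseries nvars K);
  P2 : set (mseries nvars K);
  P1_neq_P2 : P1 <> P2;
  minimal_primesP :
    forall P, minimal_prime_over (P1 `&` P2) P <-> P = P1 \/ P = P2;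
  curve_ring :> comAlgType K;
  proj : {lrmorphism mseries nvars K -> curve_ring};
  projP : is_quotient_map proj (P1 `&` P2);
  curve_dim : krull_dim curve_ring 1;
  branch1 : comAlgType K;
  branch2 : comAlgType K;
  to_branch1 : {lrmorphism curve_ring -> branch1};
  to_branch2 : {lrmorphism curve_ring -> branch2};
  branch1P : is_quotient_map (to_branch1 \o proj) P1;
  branch2P : is_quotient_map (to_branch2 \o proj) P2;
  nu1 : {lrmorphism branch1 -> mseries 1 K};
  nu2 : {lrmorphism branch2 -> mseries 1 K};
  nu1P : is_normalization nu1;
  nu2P : is_normalization nu2
}.

Definition value (K : fieldType) (C : algebroid_curve2 K) (r : C) :
    enat * enat :=
  (ms_order (nu1 C (to_branch1 C r)), ms_order (nu2 C (to_branch2 C r))).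

(* In a commutative ring, [GRing.lreg r] says that r is not a zerodivisor. *)
Definition value_semigroup (K : fieldType) (C : algebroid_curve2 K) :
    set (nat * nat) :=
  [set a | exists2 r : C, GRing.lreg r & value r = fin2 a].

End CommutativeAlgebra.

(* Main.v *)
From HB Require Import structures.
Require Import Defs.
From mathcomp Require Import all_boot all_order all_algebra.
From mathcomp Require Import boolp classical_sets cardinality.
From mathcomp Require Import mpoly zify.

(* Let eta = {alpha_1, ..., alpha_k} be a set of irreducible absolute elements
   with S minimal over eta, let m be the maximal ideal of R, and choose r_i in m
   with value alpha_i.  The K-algebra B = K + sum_i K r_i + m^2 contains every
   element of large enough value, which makes v(B) a good semigroup; it contains
   eta and is contained in S, so v(B) = S by minimality.  A subalgebra of R
   containing the elements of large value and having the same values as R is R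
   itself, so m = sum_i K r_i + m^2, and the r_i generate m by Nakayama.
   Taking m^2 into B, rather than working with K[[r_1, ..., r_k]], is what gives
   v(B) a conductor.  That m^2 contains the elements of large value follows from
   the completeness of R: dividing by an element w of value (N, N), any pair of
   power series of orders at least N is expanded as a series in w with
   coefficients in R. *)

(** * Formal power series *)

Section PowerSeries.
Set Implicit Arguments.
Unset Strict Implicit.
Import GRing.Theory.
Local Open Scope ring_scope.
Context {n : nat} {K : comNzRingType}.
Implicit Types (f g h : mseries n K) (m : 'X_{1..n}).

Lemma ms_coefM f g m : (f * g) m =
  \sum_(k : 'X_{1..n < (mdeg m).+1, (mdeg m).+1} | m == (k.1 + k.2)%MM)
    f k.1 * g k.2.
Proof. by []. Qed.

Lemma ms_coefD f g m : (f + g) m = f m + g m. Proof. by []. Qed.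
Lemma ms_coefB f g m : (f - g) m = f m - g m. Proof. by []. Qed.
Lemma ms_coefZ c f m : (c *: f) m = c * f m. Proof. by []. Qed.
Lemma ms_coef1 m : (1 : mseries n K) m = (m == 0%MM)%:R. Proof. by []. Qed.

Lemma ms_coef_sum I (r : seq I) (P : pred I) (F : I -> mseries n K) m :
  (\sum_(i <- r | P i) F i) m = \sum_(i <- r | P i) F i m.
Proof. by elim/big_rec2: _ => // i a b _ <-. Qed.

(** Order at least [k], in a form that also covers the zero series, so that sums and differences
    need no separate case of infinite order. *)
Definition ms_vanish f k := forall m, (mdeg m < k)%N -> f m = 0.

Lemma ms_vanish0 k : ms_vanish 0 k. Proof. by []. Qed.

Lemma ms_vanishW f k l : (l <= k)%N -> ms_vanish f k -> ms_vanish f l.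
Proof. by move=> lk fk m ml; apply: fk; apply: leq_trans lk. Qed.

Lemma ms_vanishD f g k : ms_vanish f k -> ms_vanish g k -> ms_vanish (f + g) k.
Proof. by move=> fk gk m mk; rewrite ms_coefD fk ?gk ?addr0. Qed.

Lemma ms_vanishZ c f k : ms_vanish f k -> ms_vanish (c *: f) k.
Proof. by move=> fk m mk; rewrite ms_coefZ fk ?mulr0. Qed.

Lemma ms_vanishB f g k : ms_vanish f k -> ms_vanish g k -> ms_vanish (f - g) k.
Proof. by move=> fk gk m mk; rewrite ms_coefB fk ?gk ?subr0. Qed.

Lemma ms_vanishM f g k l :
  ms_vanish f k -> ms_vanish g l -> ms_vanish (f * g) (k + l).
Proof.
move=> fk gl m mkl; rewrite ms_coefM big1 // => -[[a a_lt] [b b_lt]] /=.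
move=> /eqP m_ab; have [ak|ka] := ltnP (mdeg a) k; first by rewrite fk ?mul0r.
rewrite gl ?mulr0 // -(ltn_add2l k) (leq_ltn_trans _ mkl) //.
by rewrite m_ab mdegD leq_add2r.
Qed.

Lemma ms_vanishX f j : ms_vanish f 1 -> ms_vanish (f ^+ j) j.
Proof.
move=> f1; elim: j => [|j IH] //; rewrite exprS -addn1 addnC.
exact: ms_vanishM.
Qed.

Lemma ms_vanish1P f : ms_vanish f 1 <-> f 0%MM = 0.
Proof.
split=> [|f0 m]; first by apply; rewrite mdeg0.
by rewrite ltnS leqn0 mdeg_eq0 => /eqP ->.
Qed.

Lemma ms_vanish_eq0 f : (forall k, ms_vanish f k) -> f = 0.
Proof. by move=> f0; apply: mseriesP => m; apply: (f0 (mdeg m).+1). Qed.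

Lemma ms_coefM0 f g : (f * g) 0%MM = f 0%MM * g 0%MM.
Proof.
pose b0 : 'X_{1..n < (mdeg (0%MM : 'X_{1..n})).+1} := BMultinom (ltnSn _).
rewrite ms_coefM (bigD1 (b0, b0)) /=; last by rewrite addm0.
rewrite big1 ?addr0 // => -[[a a_lt] [b b_lt]] /= /andP[].
rewrite eq_sym mnmD_eq0 => /andP[/eqP a0 /eqP b0']; subst a b.
by move=> /eqP[]; congr pair; apply: val_inj.
Qed.

Definition ms_const f := f 0%MM.

Fact ms_const_is_zmod_morphism : zmod_morphism ms_const. Proof. by []. Qed.

Fact ms_const_is_monoid_morphism : monoid_morphism ms_const.
Proof.
by split=> [|f g]; [rewrite /ms_const ms_coef1 eqxx | apply: ms_coefM0].
Qed.

HB.instance Definition _ := GRing.isZmodMorphism.Build (mseries n K) K ms_const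
  ms_const_is_zmod_morphism.
HB.instance Definition _ := GRing.isMonoidMorphism.Build (mseries n K) K
  ms_const ms_const_is_monoid_morphism.

Lemma ms_constZ c f : ms_const (c *: f) = c * ms_const f. Proof. by []. Qed.

(* [G k] is the sum of the series of the [f ^+ j * s (k + j)]. *)
Lemma ms_sum f (s : nat -> mseries n K) : f 0%MM = 0 ->
  exists G : nat -> mseries n K, forall k, G k = s k + f * G k.+1.
Proof.
move=> /ms_vanish1P f0.
pose P d k := \sum_(j < d) f ^+ j * s (k + j)%N.
(* As [f] has no constant term, the terms from [j = d] on do not touch degrees below [d]: each
   coefficient stabilises, which defines the infinite sum. *)
have PE d e k m : (mdeg m < d)%N -> (d <= e)%N -> P e k m = P d k m.
  move=> md de; rewrite /P -(subnKC de) big_split_ord ms_coefD.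
  rewrite [X in _ + X]ms_coef_sum [X in _ + X]big1 ?addr0 // => j _.
  apply: (@ms_vanishM _ _ d 0) => //; last by rewrite addn0.
  by apply: (ms_vanishW (leq_addr j d)); apply: ms_vanishX.
exists (fun k => MSeries (fun m => P (mdeg m).+1 k m)) => k.
apply: mseriesP => m /=.
rewrite -(@PE _ (mdeg m).+2) // /P big_ord_recl expr0 mul1r addn0.
rewrite !ms_coefD; congr (_ + _).
have -> : \sum_(i < (mdeg m).+1) f ^+ bump 0 i * s (k + bump 0 i)%N =
          f * P (mdeg m).+1 k.+1.
  rewrite mulr_sumr; apply: eq_bigr => i _.
  by rewrite /bump /= add1n exprS mulrA addSnnS.
rewrite !ms_coefM; apply: eq_bigr => -[[a a_lt] [b b_lt]] /= _.
by rewrite -(@PE (mdeg b).+1 (mdeg m).+1).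
Qed.

End PowerSeries.

Arguments ms_const : simpl never.

(** * Units and constant terms over a field *)

Section PowerSeriesField.
Set Implicit Arguments.
Unset Strict Implicit.
Import GRing.Theory.
Local Open Scope ring_scope.
Context {n : nat} {K : fieldType}.
Implicit Types (f g h : mseries n K) (m : 'X_{1..n}).

(** The geometric series: up to its constant term, [f] is [1 - e] with [e] of positive order, and
    [G 0] sums the powers of [e]. *)
Lemma ms_inv f : ms_const f != 0 -> exists g, f * g = 1.
Proof.
move=> f0; pose e := 1 - (f 0%MM)^-1 *: f.
have e0 : e 0%MM = 0.
  by rewrite /e ms_coefB ms_coefZ ms_coef1 eqxx mulVf ?subrr.
have [G GE] := ms_sum (fun=> 1) e0.
(* [ms_sum] gives only a recursion. Each difference [G j - G j.+1] is [e] times the next one, hence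
   vanishes to every order. *)
have G01 : G 0 = G 1.
  apply/eqP; rewrite -subr_eq0; apply/eqP/ms_vanish_eq0 => k.
  have : forall j, ms_vanish (G j - G j.+1) k.
    elim: k => // k IH j.
    have -> : G j - G j.+1 = e * (G j.+1 - G j.+2).
      by rewrite (GE j) [in X in _ - X](GE j.+1) mulrBr opprD addrACA subrr
        add0r.
    by rewrite -[k.+1]add1n; apply: ms_vanishM => //; apply/ms_vanish1P.
  exact.
exists ((f 0%MM)^-1 *: G 0); rewrite -scalerAr scalerAl.
have -> : (f 0%MM)^-1 *: f = 1 - e by rewrite /e opprB addrC subrK.
by rewrite mulrBl mul1r {1}(GE 0) G01 addrK.
Qed.

(** An algebraic argument, without continuity of [phi]: if the constant terms differed, subtracting
    that of [phi f] from [f] would leave a unit whose image has constant term zero. *)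
Lemma ms_morph_const n' (phi : {lrmorphism mseries n K -> mseries n' K}) f :
  ms_const (phi f) = ms_const f.
Proof.
apply: contrapT => /eqP neq.
have [|g fg] := @ms_inv (f - ms_const (phi f) *: 1).
  by rewrite rmorphB /= ms_constZ rmorph1 mulr1 subr_eq0 eq_sym.
have := congr1 (fun h => ms_const (phi h)) fg.
rewrite !rmorphM !rmorphB /= linearZ /= ms_constZ !rmorph1 mulr1 subrr mul0r.
by move=> /esym/eqP; rewrite oner_eq0.
Qed.

End PowerSeriesField.

(** * Monomials and the ideal of the variables *)

Section Monomials.
Set Implicit Arguments.
Unset Strict Implicit.
Import GRing.Theory.
Local Open Scope ring_scope.
Context {n : nat} {K : comNzRingType}.
Implicit Types (f g h : mseries n K) (m a : 'X_{1..n}).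

Definition ms_mono a : mseries n K := MSeries (fun m => (m == a)%:R).

Lemma ms_coefM_mono f a m :
  (f * ms_mono a) m = if (a <= m)%MM then f (m - a)%MM else 0.
Proof.
rewrite ms_coefM; case: ifPn => [am|am].
  have lt1 : (mdeg (m - a)%MM < (mdeg m).+1)%N by rewrite ltnS mdegB.
  have lt2 : (mdeg a < (mdeg m).+1)%N
    by rewrite ltnS -(submK am) mdegD leq_addl.
  rewrite (bigD1 (BMultinom lt1, BMultinom lt2)) /= ?submK //.
  rewrite eqxx mulr1 big1 ?addr0 // => -[[x x_lt] [y y_lt]] /= /andP[/eqP mxy].
  have [ya|_] := eqVneq y a; last by rewrite mulr0.
  by move=> /eqP[]; congr pair; apply: val_inj; rewrite //= mxy ya addmK.
rewrite big1 // => -[[x x_lt] [y y_lt]] /= /eqP mxy.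
have [ya|_] := eqVneq y a; last by rewrite mulr0.
by move: am; rewrite mxy ya lem_addl.
Qed.

Lemma ms_maximal_gen f : ms_const f = 0 ->
  exists g : 'I_n -> mseries n K, f = \sum_i g i * ms_mono U_(i)%MM.
Proof.
(* Each monomial other than 1 is assigned to a single variable dividing it, so that it is counted in
   only one [g i]. *)
move=> f0; pose piv m := [pick i | m i != 0].
exists (fun i => MSeries (fun m =>
  if piv (m + U_(i))%MM == Some i then f (m + U_(i))%MM else 0)).
apply: mseriesP => m; rewrite ms_coef_sum.
have leU j : (U_(j) <= m)%MM = (m j != 0).
  apply/mnm_lepP/idP => [/(_ j)|mj k]; first by rewrite mnm1E eqxx lt0n.
  by rewrite mnm1E; case: eqP => [<-|//]; rewrite lt0n.
have -> : \sum_(i < n) (MSeries (fun m0 => if piv (m0 + U_(i))%MM == Some i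
    then f (m0 + U_(i))%MM else 0) * ms_mono U_(i)%MM) m =
    \sum_(i < n) if piv m == Some i then f m else 0.
  apply: eq_bigr => i _; rewrite ms_coefM_mono leU.
  have [mi|mi] /= := boolP (m i != 0); first by rewrite submK ?leU.
  by case: eqP => // pivi; move: mi; move: pivi; rewrite /piv;
    case: pickP => // j mj [<-]; rewrite mj.
case pivm: (piv m) => [j|].
  by rewrite (bigD1 j) //= eqxx big1 ?addr0 // => i /eqP/nesym ij;
    case: eqP => // -[].
rewrite big1 //; move: pivm; rewrite /piv; case: pickP => // m0 _.
have -> : m = 0%MM by apply/mnmP => i; rewrite mnm0E; have /negbFE/eqP := m0 i.
exact: f0.
Qed.

End Monomials.

(** * Orders of power series in one variable *)

Section OneVariable.
Set Implicit Arguments.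
Unset Strict Implicit.
Import GRing.Theory.
Local Open Scope ring_scope.
Context {K : fieldType}.
Local Notation A := (mseries 1 K).
Implicit Types (f g h : A) (m : 'X_{1..1}).

Definition mnm_pow p : 'X_{1..1} := (U_(ord0) *+ p)%MM.

Lemma mdeg_pow p : mdeg (mnm_pow p) = p.
Proof. by rewrite mdegMn mdeg1 mul1n. Qed.

Lemma mnm_powK m : mnm_pow (mdeg m) = m.
Proof.
apply/mnmP => i; rewrite mulmnE mdegE big_ord1 mnm1E.
by rewrite (ord1 i) eqxx mul1n.
Qed.

Lemma mnm_powD p q : mnm_pow (p + q) = (mnm_pow p + mnm_pow q)%MM.
Proof. by rewrite -[RHS]mnm_powK mdegD !mdeg_pow. Qed.

Definition ms_coef f p := f (mnm_pow p).

Lemma ms_vanishS f p : ms_vanish f p.+1 <-> ms_vanish f p /\ ms_coef f p = 0.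
Proof.
split=> [fp|[fp fp0] m]; first split.
- exact: ms_vanishW fp.
- by apply: fp; rewrite mdeg_pow.
- rewrite ltnS leq_eqVlt => /predU1P[mp|/fp//].
  by rewrite -(mnm_powK m) mp.
Qed.

(** In any splitting of the degree [p + q] other than [(p, q)], one factor is read below its
    order. *)
Lemma ms_coefM_lead f g p q : ms_vanish f p -> ms_vanish g q ->
  ms_coef (f * g) (p + q) = ms_coef f p * ms_coef g q.
Proof.
move=> fp gq; rewrite /ms_coef ms_coefM.
have lt1 : (mdeg (mnm_pow p) < (mdeg (mnm_pow (p + q))).+1)%N.
  by rewrite !mdeg_pow ltnS leq_addr.
have lt2 : (mdeg (mnm_pow q) < (mdeg (mnm_pow (p + q))).+1)%N.
  by rewrite !mdeg_pow ltnS leq_addl.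
rewrite (bigD1 (BMultinom lt1, BMultinom lt2)) /=; last by rewrite mnm_powD.
rewrite big1 ?addr0 // => -[[x x_lt] [y y_lt]] /= /andP[/eqP xy neq].
have {}xy := congr1 mdeg xy; rewrite mdegD mdeg_pow in xy.
have [xp|px|xp] := ltngtP (mdeg x) p; first by rewrite fp ?mul0r.
  by rewrite gq ?mulr0 // -(ltn_add2l p) xy ltn_add2r.
case/eqP: neq; congr pair; apply: val_inj => /=; first by rewrite -xp mnm_powK.
by rewrite -(mnm_powK y); congr mnm_pow; lia.
Qed.

Lemma ms_order_someP f p :
  ms_order f = Some p <-> ms_vanish f p /\ ms_coef f p != 0.
Proof.
rewrite /ms_order; case: pselect => [ex_k|no_k]; last first.
  split=> // -[_ /eqP fp]; case: no_k; exists p; apply/asboolP.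
  by exists (mnm_pow p); rewrite mdeg_pow.
case: ex_minnP => k /asboolP[m [mk fm]] k_min.
have fk : ms_vanish f k.
  move=> m' m'k; apply: contrapT => fm'.
  by have := k_min _ (asboolT (ex_intro _ m' (conj erefl fm')));
    rewrite leqNgt m'k.
have fk0 : ms_coef f k != 0 by apply/eqP; rewrite /ms_coef -mk mnm_powK.
split=> [[<-] //|[fp fp0]]; congr Some; apply/eqP; rewrite eqn_leq.
apply/andP; split; rewrite leqNgt; apply/negP => lt.
  by move/eqP: fp0; apply; apply: fk; rewrite mdeg_pow.
by move/eqP: fk0; apply; apply: fp; rewrite mdeg_pow.
Qed.

Lemma ms_order_noneP f : ms_order f = None <-> f = 0.
Proof.
rewrite /ms_order; case: pselect => [ex_k|no_k]; last first.
  split=> // _; apply: mseriesP => m; apply: contrapT => fm; apply: no_k.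
  by exists (mdeg m); apply/asboolP; exists m.
split=> // f0; exfalso; case: ex_k => k /asboolP[m [_]].
by rewrite f0.
Qed.

Lemma ms_order0 : ms_order (0 : A) = None.
Proof. exact/ms_order_noneP. Qed.

Lemma ms_orderM f g : ms_order (f * g) = eadd (ms_order f) (ms_order g).
Proof.
case fp: (ms_order f) => [p|]; last first.
  by move/ms_order_noneP: fp => ->; rewrite mul0r ms_order0.
case gq: (ms_order g) => [q|]; last first.
  by move/ms_order_noneP: gq => ->; rewrite mulr0 ms_order0.
move/ms_order_someP: fp => [fp fp0]; move/ms_order_someP: gq => [gq gq0].
apply/ms_order_someP; split; first exact: ms_vanishM.
by rewrite ms_coefM_lead // mulf_neq0.
Qed.

Lemma ms_order1 : ms_order (1 : A) = Some 0%N.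
Proof.
apply/ms_order_someP; split=> //; rewrite /ms_coef /mnm_pow mulm0n.
by rewrite ms_coef1 eqxx oner_eq0.
Qed.

Lemma ms_order_mono p : ms_order (ms_mono (mnm_pow p) : A) = Some p.
Proof.
apply/ms_order_someP; split=> [m mp|];
  last by rewrite /ms_coef /= eqxx oner_eq0.
by rewrite /=; case: eqP => // mE; rewrite mE mdeg_pow ltnn in mp.
Qed.

Lemma ms_vanish_order f p q :
  ms_order f = Some q -> ms_vanish f p <-> (p <= q)%N.
Proof.
move=> /ms_order_someP[fq fq0]; split=> [fp|pq]; last exact: ms_vanishW fq.
by rewrite leqNgt; apply: contra_neqN fq0 => qp; apply: fp; rewrite mdeg_pow.
Qed.

Lemma ms_shift f p q : ms_vanish f (p + q) ->
  exists2 g, f = g * ms_mono (mnm_pow p) &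
    ms_vanish g q /\ ms_const g = ms_coef f p.
Proof.
move=> fpq; exists (MSeries (fun m => f (m + mnm_pow p)%MM)); last split.
- apply: mseriesP => m; rewrite ms_coefM_mono; case: ifPn => [pm|pm].
    by rewrite /= submK.
  apply: fpq; rewrite (leq_trans _ (leq_addr _ _)) // ltnNge; apply: contra pm.
  move=> pm; apply/mnm_lepP => i; rewrite -(mnm_powK m) !mulmnE (ord1 i).
  by rewrite mnm1E eqxx !mul1n.
- by move=> m mq /=; apply: fpq; rewrite mdegD mdeg_pow addnC ltn_add2l.
- by rewrite /ms_const /= add0m.
Qed.

(** [w] is a unit times the [p]-th power of the variable, so the division reduces to a shift of
    exponents. *)
Lemma ms_div w f p q : ms_order w = Some p -> ms_vanish f (p + q) ->
  exists2 g, f = w * g & ms_vanish g q.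
Proof.
move=> /ms_order_someP[wp wp0] fpq.
have [|u wu [_ u0]] := @ms_shift w p 0; first by rewrite addn0.
have [|v uv] := @ms_inv _ _ u; first by rewrite u0.
have [g -> [gq _]] := ms_shift fpq.
exists (v * g); last by rewrite -[q]add0n; apply: ms_vanishM.
by rewrite wu mulrACA uv mul1r mulrC.
Qed.

End OneVariable.

(** * Cancellation of leading terms *)

Section Orders.
Set Implicit Arguments.
Unset Strict Implicit.
Import GRing.Theory.
Local Open Scope ring_scope.
Context {K : fieldType}.
Local Notation A := (mseries 1 K).
Implicit Types (f g h : A).

Lemma ms_orderD_lt f g p :
  ms_order f = Some p -> ms_vanish g p.+1 -> ms_order (f + g) = Some p.
Proof.
move=> /ms_order_someP[fp fp0] /ms_vanishS[gp gp0]; apply/ms_order_someP.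
by split; [exact: ms_vanishD | rewrite /ms_coef ms_coefD -/(ms_coef g p) gp0
  addr0].
Qed.

Lemma ms_cancel f g p : ms_vanish f p -> ms_order g = Some p ->
  ms_vanish (f - (ms_coef f p / ms_coef g p) *: g) p.+1.
Proof.
move=> fp /ms_order_someP[gp gp0]; apply/ms_vanishS; split.
  by apply: ms_vanishB => //; apply: ms_vanishZ.
by rewrite /ms_coef ms_coefB ms_coefZ divfK // subrr.
Qed.

(** Only the zero series has to be changed. The monomial of order [N + p] is high enough both to be
    liftable to the ring and to respect the bound [p]. *)
Lemma ms_finite_order f p N : ms_vanish f p -> exists g x,
  [/\ ms_vanish g N, ms_order (f + g) = Some x & (p <= x)%N].
Proof.
move=> fp; case fx: (ms_order f) => [x|].
  exists 0, x; split=> //; first by rewrite addr0.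
  by move/(ms_vanish_order _ fx): fp.
move/ms_order_noneP: fx => ->; exists (ms_mono (mnm_pow (N + p))), (N + p)%N.
split; [|by rewrite add0r ms_order_mono|exact: leq_addl].
by apply/ms_vanish_order; [exact: ms_order_mono | exact: leq_addr].
Qed.

End Orders.

(** * Raising values inside a subspace *)

Section SubspaceValues.
Set Implicit Arguments.
Unset Strict Implicit.
Import GRing.Theory.
Local Open Scope ring_scope.
Context {K : fieldType} {R : comAlgType K}.
Local Notation A := (mseries 1 K).
Context (phi psi : {lrmorphism R -> A}) (B : set R) (N : nat).
Context (BD : forall r s, B r -> B s -> B (r + s)).
Context (BZ : forall c r, B r -> B (c *: r)).
Context (B_hit : forall f g, ms_vanish f N -> ms_vanish g N ->
  exists2 z, B z & phi z = f /\ psi z = g).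

(** The core of (G3): subtracting a multiple of [s] cancels the leading term of [r] on the first
    branch, while on the second branch the order of [s] is too high to disturb that of [r]. *)
Lemma values_raise r s p q q' : B r -> B s ->
  ms_order (phi r) = Some p -> ms_order (phi s) = Some p ->
  ms_order (psi r) = Some q -> ms_order (psi s) = Some q' -> (q < q')%N ->
  exists2 e, B e & exists2 x, (p < x)%N &
    ms_order (phi e) = Some x /\ ms_order (psi e) = Some q.
Proof.
move=> Br Bs rp sp rq sq' qq'.
pose d := r - (ms_coef (phi r) p / ms_coef (phi s) p) *: s.
have dp : ms_vanish (phi d) p.+1.
  rewrite rmorphB /= linearZ /=; apply: ms_cancel => //.
  by case/ms_order_someP: rp.
(* The difference may be zero on the first branch; a correction that is zero on the second branch
   makes its order finite. *)
have [g [x [gN gx px]]] := ms_finite_order N dp.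
have [z Bz [phiz psiz]] := B_hit gN (@ms_vanish0 _ _ N).
exists (d + z); first by apply: BD => //; apply: BD => //; rewrite -scaleNr;
  apply: BZ.
exists x => //; rewrite !(rmorphD _ d) /= phiz psiz addr0; split=> //.
rewrite rmorphB /= linearZ /= -scaleNr; apply: ms_orderD_lt => //.
by apply: ms_vanishZ; apply/ms_vanish_order; [exact: sq' | exact: qq'].
Qed.

(** One step of approximating [r] from [B]: once [z] has made the value finite, an element of [B]
    with the value of [r + z] cancels the leading term on the first branch. *)
Lemma raise_approx
    (B_val : forall r p q,
        ms_order (phi r) = Some p -> ms_order (psi r) = Some q ->
      exists2 b, B b & ms_order (phi b) = Some p /\ ms_order (psi b) = Some q)
    r p q :
  ms_vanish (phi r) p -> ms_vanish (psi r) q ->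
  exists2 b, B b & ms_vanish (phi (r - b)) p.+1 /\ ms_vanish (psi (r - b)) q.
Proof.
move=> rp rq; have [g [y [gN gy qy]]] := ms_finite_order N rq.
have [z Bz [phiz psiz]] := B_hit (@ms_vanish0 _ _ N) gN.
have [rp0|rp0] := eqVneq (ms_coef (phi r) p) 0.
  (* Zero belongs to [B] as a multiple of the element [z]. *)
  exists (0 *: z); first exact: BZ.
  by rewrite scale0r subr0; split=> //; apply/ms_vanishS.
have rzp : ms_order (phi (r + z)) = Some p.
  by rewrite rmorphD /= phiz addr0; apply/ms_order_someP.
have rzq : ms_order (psi (r + z)) = Some y by rewrite rmorphD /= psiz.
have [b Bb [bp bq]] := B_val _ _ _ rzp rzq.
pose c := ms_coef (phi (r + z)) p / ms_coef (phi b) p.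
exists (c *: b - z); first by apply: BD; [|rewrite -scaleN1r]; apply: BZ.
have -> : r - (c *: b - z) = r + z - c *: b by rewrite opprB addrA addrAC.
rewrite !(rmorphB _ (r + z)) /= !linearZ /= !scalerN; split.
  by apply: ms_cancel => //; case/ms_order_someP: rzp.
apply: ms_vanishB; last apply: ms_vanishZ.
  by apply/ms_vanish_order; first exact: rzq.
by apply/ms_vanish_order; first exact: bq.
Qed.

End SubspaceValues.

(** * The maximal ideal and its square *)

Section TwoBranches.
Set Implicit Arguments.
Unset Strict Implicit.
Import GRing.Theory.
Local Open Scope ring_scope.
Context {K : fieldType} {n : nat} {R : comAlgType K}.
Context (pr : {lrmorphism mseries n K -> R}).
Local Notation A := (mseries 1 K).
Context (phi psi : {lrmorphism R -> A}).
Context (pr_surj : forall r, exists f, pr f = r).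
Implicit Types (r s w : R) (c : K).

(** Reduction modulo the maximal ideal, read on the first branch; by [residue_psi] the second branch
    gives the same. *)
Definition residue r := ms_const (phi r).
Arguments residue : simpl never.

HB.instance Definition _ := GRing.RMorphism.copy residue (ms_const \o phi).

Lemma residue_pr f : residue (pr f) = ms_const f.
Proof. exact: (ms_morph_const (phi \o pr)). Qed.

(** Both branches see the constant term of a lift of [r] to the ambient power series ring. *)
Lemma residue_psi r : residue r = ms_const (psi r).
Proof.
have [f <-] := pr_surj r.
by rewrite residue_pr -(ms_morph_const (psi \o pr)).
Qed.

Lemma residueZ c r : residue (c *: r) = c * residue r.
Proof. by rewrite /residue linearZ. Qed.

Lemma residue_unit r : residue r != 0 -> exists s, r * s = 1.
Proof.
have [f <-] := pr_surj r; rewrite residue_pr => /ms_inv[g fg].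
by exists (pr g); rewrite -rmorphM fg rmorph1.
Qed.

(** Completeness of [R] without a topology: the series in [w] is summed in the power series ring
    above [R] and projected. *)
Lemma residue_complete w (s : nat -> R) : residue w = 0 ->
  exists G : nat -> R, forall k, G k = s k + w * G k.+1.
Proof.
have [f <-] := pr_surj w; rewrite residue_pr => f0.
have [t tE] := choice (fun k => pr_surj (s k)).
have [G GE] := ms_sum t f0.
exists (fun k => pr (G k)) => k.
by rewrite GE rmorphD rmorphM /= tE.
Qed.

Definition pr_var i : R := pr (ms_mono U_(i)%MM).

Lemma residue_var i : residue (pr_var i) = 0.
Proof. by rewrite residue_pr /ms_const /= eq_sym mnm1_eq0. Qed.

Lemma residue_gen r : residue r = 0 ->
  exists y : 'I_n -> R, r = \sum_i y i * pr_var i.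
Proof.
have [f <-] := pr_surj r; rewrite residue_pr => /ms_maximal_gen[g ->].
exists (fun i => pr (g i)); rewrite rmorph_sum.
by apply: eq_bigr => i _; rewrite rmorphM.
Qed.

(* The square of the maximal ideal, whose generators are the [pr_var i]. *)
Definition sqmax : set R := [set r | exists2 y : 'I_n -> R,
  forall i, residue (y i) = 0 & r = \sum_i y i * pr_var i].

Lemma sqmaxM r s : residue r = 0 -> residue s = 0 -> sqmax (r * s).
Proof.
move=> r0 /residue_gen[y ->]; exists (fun i => r * y i).
  by move=> i; rewrite rmorphM /= r0 mul0r.
by rewrite mulr_sumr; apply: eq_bigr => i _; rewrite mulrA.
Qed.

Lemma sqmaxD r s : sqmax r -> sqmax s -> sqmax (r + s).
Proof.
move=> [y y0 ->] [z z0 ->]; exists (fun i => y i + z i).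
  by move=> i; rewrite rmorphD /= y0 z0 addr0.
by rewrite -big_split; apply: eq_bigr => i _; rewrite mulrDl.
Qed.

Lemma sqmaxZ c r : sqmax r -> sqmax (c *: r).
Proof.
move=> [y y0 ->]; exists (fun i => c *: y i).
  by move=> i; rewrite residueZ y0 mulr0.
by rewrite scaler_sumr; apply: eq_bigr => i _; rewrite scalerAl.
Qed.

Lemma residue_sqmax r : sqmax r -> residue r = 0.
Proof.
move=> [y y0 ->]; rewrite rmorph_sum big1 // => i _.
by rewrite rmorphM /= y0 mul0r.
Qed.

(** The determinant trick: [Y] sends the vector of generators into the span of the [g i], and it is
    the identity modulo the maximal ideal, hence inverted by means of its adjugate. *)
Lemma nakayama k (g : 'I_k -> R) :
  (forall r, residue r = 0 -> exists a : 'I_k -> R,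
     exists2 s, sqmax s & r = \sum_i a i * g i + s) ->
  forall r, residue r = 0 -> generated_ideal g r.
Proof.
move=> max_g.
have /choice[a /choice[y ayP]] : forall i, exists a, exists y : 'I_n -> R,
    (forall j, residue (y j) = 0) /\
    pr_var i = \sum_j a j * g j + \sum_j y j * pr_var j.
  move=> i; have [a [s [y y0 ->] iE]] := max_g _ (residue_var i).
  by exists a, y.
pose Y : 'M[R]_n := 1%:M - \matrix_(i, j) y i j.
pose x : 'cV[R]_n := \col_i pr_var i.
pose h : 'cV[R]_k := \col_i g i.
have Yx : Y *m x = (\matrix_(i, j) a i j) *m h.
  apply/colP => i; rewrite mulmxBl mul1mx !mxE.
  under [X in _ - X]eq_bigr => j _ do rewrite !mxE.
  under [RHS]eq_bigr => j _ do rewrite !mxE.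
  by rewrite {1}(proj2 (ayP i)) addrK.
have detY : residue (\det Y) = 1.
  have -> : residue (\det Y) = \det (map_mx residue Y) by rewrite -det_map_mx.
  have -> : map_mx residue Y = 1%:M.
    apply/matrixP => i j; rewrite !mxE rmorphB /= (proj1 (ayP i)) subr0.
    by rewrite rmorph_nat.
  by rewrite det1.
have [|d dY] := @residue_unit (\det Y); first by rewrite detY oner_neq0.
have xE : x = (d *: (\adj Y *m \matrix_(i, j) a i j)) *m h.
  rewrite -scalemxAl -mulmxA -Yx mulmxA mul_adj_mx mul_scalar_mx scalerA.
  by rewrite mulrC dY scale1r.
move=> r /residue_gen[z ->].
pose z' : 'rV[R]_n := \row_i z i.
exists (fun i => (z' *m (d *: (\adj Y *m \matrix_(i, j) a i j))) 0 i).
transitivity ((z' *m x) 0 0).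
  by rewrite mxE; apply: eq_bigr => i _; rewrite !mxE.
rewrite {1}xE mulmxA mxE; apply: eq_bigr => i _.
by rewrite [h _ _]mxE.
Qed.

(** * Elements of large value *)

Section Conductor.
Context (m : nat) (m_gt0 : (0 < m)%N).
Context (val_hit : forall p q, (m <= p)%N -> (m <= q)%N -> exists r,
  ms_order (phi r) = Some p /\ ms_order (psi r) = Some q).

(** [u] has value [(m + k, m + k + 1)] and [v] the reverse, so each cancels the leading term on one
    branch without disturbing the other. *)
Lemma approx_conductor k (f g : A) : ms_vanish f m -> ms_vanish g m ->
  exists s, ms_vanish (f - phi s) (m + k) /\ ms_vanish (g - psi s) (m + k).
Proof.
move=> fm gm; elim: k => [|k [s [fs gs]]].
  by exists 0; rewrite !rmorph0 !subr0 addn0.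
have mk : (m <= m + k)%N by apply: leq_addr.
have [u [u1 u2]] := val_hit mk (leqW mk).
have [v [v1 v2]] := val_hit (leqW mk) mk.
pose c := ms_coef (f - phi s) (m + k) / ms_coef (phi u) (m + k).
pose d := ms_coef (g - psi s) (m + k) / ms_coef (psi v) (m + k).
exists (s + c *: u + d *: v);
  rewrite !rmorphD /= !linearZ /= !opprD !addrA addnS.
split; last rewrite addrAC.
  apply: ms_vanishB; first exact: ms_cancel.
  by apply: ms_vanishZ; apply/ms_vanish_order; first exact: v1.
apply: ms_vanishB; first exact: ms_cancel.
by apply: ms_vanishZ; apply/ms_vanish_order; first exact: u2.
Qed.

Lemma conductor_surj (f g : A) : ms_vanish f m -> ms_vanish g m ->
  exists r, phi r = f /\ psi r = g.
Proof.
move=> fm gm; have [w [w1 w2]] := val_hit (leqnn m) (leqnn m).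
have w_van : ms_vanish (phi w) 1 /\ ms_vanish (psi w) 1.
  by split; apply/ms_vanish_order; [exact: w1 | | exact: w2 |].
have w0 : residue w = 0 by apply: w_van.1; rewrite mdeg0.
(* One division step: a pair of orders at least [m] is approximated to order [m + m] from [R], and
   the remainder divided by [w] has orders at least [m] again, so the step can be iterated. *)
have /choice[F FP] : forall a : A * A, exists b : R * (A * A),
    ms_vanish a.1 m -> ms_vanish a.2 m ->
    [/\ a.1 = phi b.1 + phi w * b.2.1, a.2 = psi b.1 + psi w * b.2.2,
        ms_vanish b.2.1 m & ms_vanish b.2.2 m].
  move=> [a1 a2] /=; have [am|nam] :=
    pselect (ms_vanish a1 m /\ ms_vanish a2 m).
    have [s [s1 s2]] := approx_conductor m am.1 am.2.
    have [b1 b1E b1m] := ms_div w1 s1; have [b2 b2E b2m] := ms_div w2 s2.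
    by exists (s, (b1, b2)) => _ _ /=;
      rewrite -b1E -b2E (addrC (phi s)) (addrC (psi s)) !subrK.
  (* A dummy value, since [F] is defined on all pairs. *)
  by exists (0, (0, 0)) => am1 am2; case: nam.
pose a k := iter k (fun a => (F a).2) (f, g).
have aP k : ms_vanish (a k).1 m /\ ms_vanish (a k).2 m.
  by elim: k => [|k [IH1 IH2]] //; rewrite /a iterS -/(a k);
    case: (FP _ IH1 IH2).
have [G GE] := residue_complete (fun k => (F (a k)).1) w0.
(* The error at stage [k] is [w] times the error at the next stage. As [w] has positive orders, all
   errors vanish to every order. *)
have aE k : (a k).1 - phi (G k) = phi w * ((a k.+1).1 - phi (G k.+1)) /\
            (a k).2 - psi (G k) = psi w * ((a k.+1).2 - psi (G k.+1)).
  have [aP1 aP2] := aP k; have [e1 e2 _ _] := FP _ aP1 aP2.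
  rewrite e1 e2 (GE k) !rmorphD !rmorphM /= !mulrBr.
  by split; rewrite opprD addrACA subrr add0r.
have van l : forall k, ms_vanish ((a k).1 - phi (G k)) l /\
                       ms_vanish ((a k).2 - psi (G k)) l.
  elim: l => // l IH k; rewrite (aE k).1 (aE k).2 -[l.+1]add1n.
  have [IH1 IH2] := IH k.+1; case: w_van => wv1 wv2.
  by split; apply: ms_vanishM.
exists (G 0); split; apply/esym/eqP; rewrite -subr_eq0;
  apply/eqP/ms_vanish_eq0 => l.
  exact: (van l 0).1.
exact: (van l 0).2.
Qed.

(** Order [m + m] leaves order [m] after division by [w], so the quotient lifts to [R]; as [m] is
    positive, both [w] and the lift lie in the maximal ideal. *)
Lemma conductor_sqmax (f g : A) : ms_vanish f (m + m) -> ms_vanish g (m + m) ->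
  exists2 r, sqmax r & phi r = f /\ psi r = g.
Proof.
move=> fm gm; have [w [w1 w2]] := val_hit (leqnn m) (leqnn m).
have [f' -> f'm] := ms_div w1 fm; have [g' -> g'm] := ms_div w2 gm.
have [r [r1 r2]] := conductor_surj f'm g'm.
exists (w * r); last by rewrite !rmorphM /= r1 r2.
apply: sqmaxM; last by rewrite /residue r1; apply: f'm; rewrite mdeg0.
suff wv : ms_vanish (phi w) 1 by apply: wv; rewrite mdeg0.
by apply/ms_vanish_order; first exact: w1.
Qed.

End Conductor.

End TwoBranches.

(** * Values of subalgebras *)

Section Values.
Set Implicit Arguments.
Unset Strict Implicit.
Import GRing.Theory.
Local Open Scope ring_scope.
Context {K : fieldType} {R : comAlgType K}.
Local Notation A := (mseries 1 K).
Context (phi psi : {lrmorphism R -> A}).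
Implicit Types (B : set R) (r s : R) (c : K).

Definition bivalue r := (ms_order (phi r), ms_order (psi r)).

Definition values B : set (nat * nat) :=
  [set a | exists2 r, B r & bivalue r = fin2 a].

Context (B : set R) (N : nat).
Context (B1 : B 1).
Context (BD : forall r s, B r -> B s -> B (r + s)).
Context (BZ : forall c r, B r -> B (c *: r)).
Context (BM : forall r s, B r -> B s -> B (r * s)).
Context (B_hit : forall f g, ms_vanish f N -> ms_vanish g N ->
  exists2 z, B z & phi z = f /\ psi z = g).

(** Allows the lemmas about the first branch to be applied with [phi] and [psi] exchanged. *)
Lemma B_hitC f g : ms_vanish f N -> ms_vanish g N ->
  exists2 z, B z & psi z = f /\ phi z = g.
Proof. by move=> fN gN; have [z Bz [<- <-]] := B_hit gN fN; exists z. Qed.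

(** On each branch the two orders differ, so nothing cancels in the sum. Up to symmetry this is the
    only case of (G1) where the minimum is neither [a] nor [b]. *)
Lemma values_min_lt a b : values B a -> values B b ->
  (a.1 < b.1)%N -> (b.2 < a.2)%N -> values B (a.1, b.2).
Proof.
move=> [r Br [ra1 ra2]] [s Bs [sb1 sb2]] lt1 lt2.
exists (r + s); [exact: BD | rewrite /bivalue !rmorphD /=].
congr pair; last rewrite addrC; apply: ms_orderD_lt => //.
  by apply/ms_vanish_order; first exact: sb1.
by apply/ms_vanish_order; first exact: ra2.
Qed.

(** Locality is a hypothesis because it will be inherited from [S]. For (G3), distinct pairs that
    agree in one coordinate differ in the other, which gives the strict inequality of
    [values_raise]. *)
Lemma values_good :
  (forall a, values B a -> a.1 = 0%N \/ a.2 = 0%N -> a = (0%N, 0%N)) ->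
  good_semigroup (values B).
Proof.
move=> loc; split=> //.
- split; first by exists 1 => //; rewrite /bivalue !rmorph1 !ms_order1.
  move=> a b [r Br [ra1 ra2]] [s Bs [sb1 sb2]]; exists (r * s); first exact: BM.
  by rewrite /bivalue !rmorphM /= !ms_orderM ra1 ra2 sb1 sb2.
- move=> a b Ba Bb.
  have [ab1|ba1] := leqP a.1 b.1; have [ab2|ba2] := leqP a.2 b.2.
  + by case: a Ba {Bb ab1 ab2}.
  + move: ab1; rewrite leq_eqVlt => /predU1P[->|lt1];
    first by case: b Bb {ba2 Ba}.
    exact: values_min_lt.
  + move: ab2; rewrite leq_eqVlt => /predU1P[->|lt2];
    first by case: b Bb {ba1 Ba}.
    exact: values_min_lt.
  + by case: b Bb {Ba ba1 ba2}.
- exists (N, N) => x.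
  have mono_van k : ms_vanish (ms_mono (mnm_pow (N + k)) : A) N.
    by apply/ms_vanish_order; [exact: ms_order_mono | exact: leq_addr].
  have [z Bz [z1 z2]] := B_hit (mono_van x.1) (mono_van x.2).
  by exists z => //; rewrite /bivalue z1 z2 !ms_order_mono.
- move=> a b [r Br [ra1 ra2]] [s Bs [sb1 sb2]] ab ab1.
  have [lt2|lt2|eq2] := ltngtP a.2 b.2; last by case: ab;
    apply: injective_projections.
  + rewrite -ab1 in sb1.
    have [e Be [x ax [e1 e2]]] := values_raise BD BZ B_hit Br Bs ra1 sb1 ra2
      sb2 lt2.
    by exists (x, a.2); [exists e; rewrite // /bivalue e1 e2 | split].
  + rewrite ab1 in ra1.
    have [e Be [x bx [e1 e2]]] := values_raise BD BZ B_hit Bs Br sb1 ra1 sb2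
      ra2 lt2.
    by exists (x, b.2); [exists e; rewrite // /bivalue e1 e2 | rewrite ab1;
      split].
- move=> a b [r Br [ra1 ra2]] [s Bs [sb1 sb2]] ab ab2.
  have [lt1|lt1|eq1] := ltngtP a.1 b.1; last by case: ab;
    apply: injective_projections.
  + rewrite -ab2 in sb2.
    have [e Be [x ax [e1 e2]]] := values_raise BD BZ B_hitC Br Bs ra2 sb2 ra1
      sb1 lt1.
    by exists (a.1, x); [exists e; rewrite // /bivalue e1 e2 | split].
  + rewrite ab2 in ra2.
    have [e Be [x bx [e1 e2]]] := values_raise BD BZ B_hitC Bs Br sb2 ra2 sb1
      ra1 lt1.
    by exists (b.1, x); [exists e; rewrite // /bivalue e1 e2 | rewrite ab2;
      split].
Qed.

(** If [r] is zero on one branch, adding elements of [B] that are zero on the other branch and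
    monomials on this one realises every order from [N] on. *)
Lemma Gamma_values r : B r -> Gamma (values B) (bivalue r).
Proof.
move=> Br; rewrite /Gamma /infinite_elements.
case r1: (ms_order (phi r)) => [p|]; case r2: (ms_order (psi r)) => [q|].
- by left; exists (p, q); rewrite /bivalue ?r1 ?r2 //; exists r;
  rewrite // /bivalue r1 r2.
- right; left; left; exists p; last by rewrite /bivalue r1 r2.
  exists N => y Ny; have [||z Bz [z1 z2]] := B_hit (f := 0) (g := ms_mono
    (mnm_pow y)) => //.
    by apply/ms_vanish_order; first exact: ms_order_mono.
  exists (r + z); first exact: BD.
  move/ms_order_noneP: r2 => r2.
  by rewrite /bivalue !rmorphD /= z1 z2 r2 addr0 add0r r1 ms_order_mono.
- right; left; right; exists q; last by rewrite /bivalue r1 r2.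
  exists N => y Ny; have [||z Bz [z1 z2]] := B_hit (f := ms_mono (mnm_pow y))
    (g := 0) => //.
    by apply/ms_vanish_order; first exact: ms_order_mono.
  exists (r + z); first exact: BD.
  move/ms_order_noneP: r1 => r1.
  by rewrite /bivalue !rmorphD /= z1 z2 r1 addr0 add0r r2 ms_order_mono.
- by right; right; rewrite /bivalue r1 r2.
Qed.

(** [r] is approximated from [B], one order on one branch at a time, until both orders reach [N] and
    [B_hit] provides the remainder. *)
Lemma values_full (branch_inj : forall r, phi r = 0 -> psi r = 0 -> r = 0) :
  (forall a, values setT a -> values B a) -> forall r, B r.
Proof.
move=> full.
have B_val r p q : ms_order (phi r) = Some p -> ms_order (psi r) = Some q ->
    exists2 b, B b & ms_order (phi b) = Some p /\ ms_order (psi b) = Some q.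
  move=> rp rq; have [|b Bb [b1 b2]] := full (p, q); last by exists b.
  by exists r; rewrite // /bivalue rp rq.
have B_valC r p q : ms_order (psi r) = Some p -> ms_order (phi r) = Some q ->
    exists2 b, B b & ms_order (psi b) = Some p /\ ms_order (phi b) = Some q.
  by move=> rp rq; have [b Bb [b1 b2]] := B_val _ _ _ rq rp; exists b.
(* Induction on the number of orders still missing below [N]; as subtraction is truncated, it is
   zero exactly when both bounds have reached [N]. *)
suff gap k : forall p q r, (N - p + (N - q) <= k)%N ->
    ms_vanish (phi r) p -> ms_vanish (psi r) q -> B r.
  by move=> r; apply: (gap (N + N)%N 0%N 0%N) => //; rewrite !subn0.
elim: k => [|k IH] p q r.
  rewrite leqn0 addn_eq0 !subn_eq0 => /andP[Np Nq] rp rq.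
  have [z Bz [z1 z2]] := B_hit (ms_vanishW Np rp) (ms_vanishW Nq rq).
  suff -> : r = z by [].
  by apply/eqP; rewrite -subr_eq0; apply/eqP/branch_inj;
    rewrite rmorphB /= ?z1 ?z2 subrr.
move=> le_k rp rq; have [lt_p|Np] := ltnP p N.
  have [b Bb [b1 b2]] := raise_approx BD BZ B_hit B_val rp rq.
  by rewrite -(subrK b r); apply: BD => //; apply: (IH p.+1 q) => //; lia.
have [lt_q|Nq] := ltnP q N.
  have [b Bb [b1 b2]] := raise_approx BD BZ B_hitC B_valC rq rp.
  by rewrite -(subrK b r); apply: BD => //; apply: (IH p q.+1) => //; lia.
by apply: (IH p q) => //; lia.
Qed.

End Values.

(** * Generators of the maximal ideal from minimality *)

Section Embedding.
Set Implicit Arguments.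
Unset Strict Implicit.
Import GRing.Theory.
Local Open Scope ring_scope.
Local Open Scope classical_set_scope.
Context {K : fieldType} {n : nat} {R : comAlgType K}.
Context (pr : {lrmorphism mseries n K -> R}).
Context (phi psi : {lrmorphism R -> mseries 1 K}).
Context (pr_surj : forall r, exists f, pr f = r).
Context (branch_inj : forall r, phi r = 0 -> psi r = 0 -> r = 0).
Context (S : set (nat * nat)) (S_good : good_semigroup S).
Context (S_val : values phi psi setT = S).

Lemma good_cofinite : exists2 m, (0 < m)%N &
  forall p q, (m <= p)%N -> (m <= q)%N -> exists r,
    ms_order (phi r) = Some p /\ ms_order (psi r) = Some q.
Proof.
have [[d1 d2] dS] := good_conductor S_good.
(* The sum bounds both coordinates of the conductor, and the successor makes the bound positive. *)
exists (d1 + d2).+1 => // p q dp dq.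
have := dS (p - d1, q - d2)%N; rewrite -S_val /= !subnKC; last 2 first.
- by apply: leq_trans dq; rewrite leqW // leq_addl.
- by apply: leq_trans dp; rewrite leqW // leq_addr.
by case=> r _ [r1 r2]; exists r.
Qed.

(** An infinite coordinate arises from a finite one beyond the conductor: the series of [r] on that
    branch, paired with zero on the other, lifts to [R] and is subtracted. *)
Lemma bivalue_Gamma a : Gamma S a -> exists r, bivalue phi psi r = a.
Proof.
have [m m_gt0 val_hit] := good_cofinite.
have hit f g (fm : ms_vanish f m) (gm : ms_vanish g m) :=
  conductor_surj pr_surj m_gt0 val_hit fm gm.
rewrite /Gamma -S_val => -[[b [r _ rb] <-]|[[[p [y pS] <-]|[q [x qS] <-]]|->]].
- by exists r.
- have [r _ [r1 r2]] := pS _ (leq_maxl y m).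
  have [||z [z1 z2]] := hit 0 (psi r); first by [].
    by apply/ms_vanish_order; [exact: r2 | exact: leq_maxr].
  exists (r - z); rewrite /bivalue !rmorphB /= z1 z2 subr0 subrr.
  by rewrite r1 ms_order0.
- have [r _ [r1 r2]] := qS _ (leq_maxl x m).
  have [||z [z1 z2]] := hit (phi r) 0; last 1 first.
  + exists (r - z); rewrite /bivalue !rmorphB /= z1 z2 subr0 subrr.
    by rewrite r2 ms_order0.
  + by apply/ms_vanish_order; [exact: r1 | exact: leq_maxr].
  + by [].
- by exists 0; rewrite /bivalue !rmorph0 !ms_order0.
Qed.

Lemma bivalue_unit r :
  residue phi r != 0 -> bivalue phi psi r = fin2 (0%N, 0%N).
Proof.
move=> r0; congr pair; apply/ms_order_someP; split=> //.
by move: r0; rewrite (residue_psi phi psi pr_surj).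
Qed.

Lemma embedding_bound k (alpha : 'I_k -> enat * enat) :
  (forall i, Gamma S (alpha i)) -> (forall i, alpha i <> fin2 (0%N, 0%N)) ->
  (forall T, good_semigroup T -> (forall i, Gamma T (alpha i)) ->
     T `<=` S -> T = S) ->
  exists2 g : 'I_k -> R, forall i, residue phi (g i) = 0 &
    forall r, residue phi r = 0 -> generated_ideal g r.
Proof.
move=> alphaS alpha0 min.
have [m m_gt0 val_hit] := good_cofinite.
have /choice[g gE] := fun i => bivalue_Gamma (alphaS i).
(* A nonzero residue would give the value [(0, 0)], which [alpha0] excludes. *)
have g0 i : residue phi (g i) = 0.
  by apply: contrapT => /eqP /bivalue_unit; rewrite gE => /alpha0.
exists g => //.
(* [W] is the part of [B] in the maximal ideal. Products of its elements fall into the square, which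
   closes [B] under multiplication. *)
pose W : set R := [set r | exists c : 'I_k -> K, exists2 s, sqmax pr phi s &
  r = \sum_i c i *: g i + s].
pose B : set R := [set r | exists c, exists2 w, W w & r = c *: 1 + w].
have sq0 : sqmax pr phi 0.
  by exists (fun=> 0) => [i|]; rewrite ?rmorph0 // big1 // => i _;
    rewrite mul0r.
have WS s : sqmax pr phi s -> W s.
  move=> sqs; exists (fun=> 0); exists s => //.
  by rewrite big1 ?add0r // => i _; rewrite scale0r.
have WD x y : W x -> W y -> W (x + y).
  move=> [c [s sqs ->]] [d [t sqt ->]]; exists (fun i => c i + d i);
    exists (s + t).
    exact: sqmaxD.
  rewrite addrACA -big_split; congr (_ + _).
  by apply: eq_bigr => i _; rewrite scalerDl.
have WZ c x : W x -> W (c *: x).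
  move=> [d [s sqs ->]]; exists (fun i => c * d i); exists (c *: s);
    first exact: sqmaxZ.
  by rewrite scalerDr scaler_sumr; congr (_ + _); apply: eq_bigr => i _;
    rewrite scalerA.
have W0 x : W x -> residue phi x = 0.
  move=> [c [s sqs ->]];
    rewrite rmorphD rmorph_sum /= (residue_sqmax sqs) addr0.
  by rewrite big1 // => i _; rewrite residueZ g0 mulr0.
have WB w : W w -> B w.
  by move=> Ww; exists 0; exists w => //; rewrite scale0r add0r.
have WM x y : W x -> W y -> W (x * y).
  by move=> /W0 x0 /W0 y0; apply/WS/(sqmaxM pr_surj).
have B1 : B 1 by exists 1; exists 0; rewrite ?addr0 ?scale1r //; apply: WS.
have BD x y : B x -> B y -> B (x + y).
  move=> [c [w Ww ->]] [d [v Wv ->]]; exists (c + d); exists (w + v);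
    first exact: WD.
  by rewrite addrACA scalerDl.
have BZ c x : B x -> B (c *: x).
  move=> [d [w Ww ->]]; exists (c * d); exists (c *: w); first exact: WZ.
  by rewrite scalerDr scalerA.
have BM x y : B x -> B y -> B (x * y).
  move=> [c [w Ww ->]] [d [v Wv ->]]; exists (c * d).
  exists (c *: v + d *: w + w * v).
    by apply: (WD _ _ _ (WM _ _ Ww Wv)); apply: WD; apply: WZ.
  rewrite mulrDl !mulrDr -!scalerAl -!scalerAr !mul1r mulr1 scalerA.
  by rewrite !addrA.
have B_hit f h : ms_vanish f (m + m) -> ms_vanish h (m + m) ->
    exists2 z, B z & phi z = f /\ psi z = h.
  move=> fm hm; have [z sqz zE] := conductor_sqmax pr_surj m_gt0 val_hit fm hm.
  by exists z => //; apply/WB/WS.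
have subS : values phi psi B `<=` S.
  by move=> a [r _ ra]; rewrite -S_val; exists r.
have Bg i : B (g i).
  apply: WB; exists (fun j => (j == i)%:R); exists 0 => //.
  rewrite (bigD1 i) //= eqxx scale1r big1 ?addr0 // => j /negbTE ->.
  by rewrite scale0r.
have valB : values phi psi B = S.
  apply: min => // [|i].
    apply: (values_good B1 BD BZ BM B_hit) => a /subS.
    exact: good_local.
  by rewrite -gE; apply: (Gamma_values BD B_hit).
have fullB r : B r.
  by apply: (values_full BD BZ B_hit branch_inj) => a; rewrite S_val valB.
apply: (nakayama pr_surj) => r r0.
have [c [w Ww rE]] := fullB r.
(* Taking residues kills the scalar part, so [r] lies in [W], which is the form that [nakayama]
   requires. *)
have c0 : c = 0.
  by move: r0; rewrite rE rmorphD /= (W0 _ Ww) addr0 residueZ rmorph1 mulr1.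
move: Ww; rewrite rE c0 scale0r add0r => -[d [s sqs ->]].
exists (fun i => d i *: 1); exists s => //; congr (_ + _).
by apply: eq_bigr => i _; rewrite -scalerAl mul1r.
Qed.

End Embedding.

(** * Local rings and finite indexing *)

Section LocalRing.
Set Implicit Arguments.
Unset Strict Implicit.
Import GRing.Theory.
Local Open Scope ring_scope.
Local Open Scope classical_set_scope.

(** Elements outside the kernel of [eps] are units, so every proper ideal is contained in the
    kernel. *)
Lemma local_maximal_ideal (R : comNzRingType) (L : nzRingType)
    (eps : {rmorphism R -> L}) :
  (forall r, eps r != 0 -> exists s, r * s = 1) ->
  forall M', maximal_ideal_set M' <-> M' = [set r | eps r = 0].
Proof.
move=> eps_unit; set M := [set r | eps r = 0].
have M_proper : proper_ideal_set M.
  split; first by apply/mem_set; rewrite /M /= rmorph0.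
    by apply/negP => /set_mem /eqP; rewrite rmorph1 oner_eq0.
  move=> a u v /set_mem uM /set_mem vM; apply/mem_set.
  by rewrite /M /= rmorphD rmorphM /= uM vM mulr0 addr0.
have sub_M I : proper_ideal_set I -> I `<=` M.
  move=> [I0 I1 I_closed] r Ir; apply: contrapT => /eqP /eps_unit[s rs].
  (* [1] is written as [s * r + 0], the shape of the closure condition for ideals. *)
  case/negP: I1; rewrite -rs mulrC -[_ * _]addr0.
  by apply: I_closed => //; apply/mem_set.
move=> M'; split=> [[M'_proper M'_max]|->].
  by rewrite (M'_max M) //; apply: sub_M.
by split=> // I /sub_M IM MI; apply/seteqP.
Qed.

Lemma local_edim_le (R : comNzRingType) (M : set R) k (g : 'I_k -> R) :
  (forall M', maximal_ideal_set M' <-> M' = M) -> generated_ideal g = M ->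
  exists2 d, local_edim R d & (d <= k)%N.
Proof.
move=> M_max gM.
have ex : exists k, `[< exists g : 'I_k -> R, generated_ideal g = M >].
  by exists k; apply/asboolP; exists g.
have kP : `[< exists g : 'I_k -> R, generated_ideal g = M >].
  by apply/asboolP; exists g.
exists (ex_minn ex); case: ex_minnP => d dP d_min; last exact: d_min.
by exists M => //; split; [exact/asboolP | move=> l lP; apply/d_min/asboolP].
Qed.

Lemma card_eq_range T (A : set T) k : (A #= `I_k)%card ->
  exists f : 'I_k -> T, A = range f.
Proof.
move=> /card_set_bijP[h [hA h_inj h_surj]].
have /choice[f fP] : forall i : 'I_k, exists x, A x /\ h x = i.
  by move=> i; have [x Ax hx] := h_surj _ (ltn_ord i); exists x.
exists f; apply/seteqP; split=> [x Ax|_ [i _ <-]]; last exact: (fP i).1.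
exists (Ordinal (hA _ Ax)) => //; apply: h_inj; rewrite ?(fP _).2 //.
  exact/mem_set/(fP _).1.
exact/mem_set.
Qed.

End LocalRing.

(** * Two-branches curves *)

Section Curve.
Set Implicit Arguments.
Unset Strict Implicit.
Import GRing.Theory.
Local Open Scope ring_scope.
Local Open Scope classical_set_scope.
Context {K : fieldType} (C : algebroid_curve2 K).

Lemma normalization_inj (A B : comNzRingType) (nu : {rmorphism A -> B}) :
  is_normalization nu -> injective nu.
Proof.
move=> [F [iota [j [[iota_inj _] _ jnu _]]]] a b nu_ab.
by apply: iota_inj; rewrite -!jnu nu_ab.
Qed.

Definition branch_series1 : {lrmorphism C -> mseries 1 K} :=
  nu1 C \o to_branch1 C.
Definition branch_series2 : {lrmorphism C -> mseries 1 K} :=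
  nu2 C \o to_branch2 C.

(** A lift of an element that is zero on both branches lies in [P1] and in [P2], hence in the kernel
    of the projection. *)
Lemma curve_branch_inj r :
  branch_series1 r = 0 -> branch_series2 r = 0 -> r = 0.
Proof.
have [f <-] := (projP C).1 r.
rewrite /= -[X in _ = X](rmorph0 (nu1 C)).
rewrite -[X in _ -> _ = X -> _](rmorph0 (nu2 C)).
move=> /(normalization_inj (@nu1P _ C)) /(branch1P C).2 f1.
move=> /(normalization_inj (@nu2P _ C)) /(branch2P C).2 f2.
exact/(projP C).2.
Qed.

(** Orders add in products, so if [r] has finite orders and kills [x - y], then [x - y] has infinite
    order on both branches. *)
Lemma finite_value_lreg (r : C) (a : nat * nat) :
  value r = fin2 a -> GRing.lreg r.
Proof.
move=> [r1 r2] x y rxy; apply/eqP; rewrite -subr_eq0; apply/eqP.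
have rxy0 : r * (x - y) = 0 by rewrite mulrBr rxy subrr.
apply: curve_branch_inj; apply/ms_order_noneP.
  have /ms_order_noneP : branch_series1 (r * (x - y)) = 0.
    by rewrite rxy0 rmorph0.
  rewrite rmorphM ms_orderM [X in eadd X _]r1.
  by case: (ms_order _).
have /ms_order_noneP : branch_series2 (r * (x - y)) = 0 by rewrite rxy0 rmorph0.
rewrite rmorphM ms_orderM [X in eadd X _]r2.
by case: (ms_order _).
Qed.

Lemma values_curve :
  values branch_series1 branch_series2 setT = value_semigroup C.
Proof.
apply/seteqP; split=> a [r r_reg ra]; exists r => //.
exact: finite_value_lreg ra.
Qed.

End Curve.

Theorem theorem39 (K : fieldType) (S : set (nat * nat))
    (hS : good_semigroup S) (R : algebroid_curve2 K)
    (hR : value_semigroup R = S) (eS : nat) (heS : semigroup_edim S eS) :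
  exists2 eR : nat, local_edim R eR & eR <= eS.
Proof.
have [[eta [eta_card eta_irr [_ eta_S eta_min]]] _] := heS.
have [alpha etaE] := card_eq_range eta_card.
have eta_alpha i : eta (alpha i) by rewrite etaE; exists i.
have val_S := etrans (values_curve R) hR.
have pr_surj := (projP R).1.
have [|||g g0 gM] := @embedding_bound _ _ _ (proj R) (branch_series1 R)
  (branch_series2 R) pr_surj (@curve_branch_inj _ R) S hS val_S _ alpha.
- by move=> i; apply/eta_S.
- by move=> i; have [[]] := eta_irr _ (eta_alpha i).
- move=> T T_good T_alpha; apply: eta_min => // x.
  by rewrite etaE => -[i _ <-].
(* The kernel of the residue map is the maximal ideal of [R], and the [eS] elements [g] generate
   it. *)
apply: (@local_edim_le _
  [set r | residue (branch_series1 R) r = 0%R]%classic _ g).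
  by apply: local_maximal_ideal => r; apply: (residue_unit pr_surj).
apply/seteqP; split=> [r [c ->]|r]; last exact: gM.
rewrite /= GRing.rmorph_sum big1 // => i _.
by rewrite GRing.rmorphM /= g0 GRing.mulr0.
Qed.
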